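(* Let $N\ge 1$, $X>0$, and let $g_1,\dots,g_N:[0,\infty)\to[0,\infty)$ be productivity functions (i.e. each $g_i$ satisfies $g_i(0)=0$, is non-decreasing and concave). Let $X_1^+,\dots,X_N^+\in(0,\infty]$ with $\sum_i X_i^+\ge X$, and consider the capped funding conditions, i.e. the set of feasible budgets $$B=\Big\{x\in\mathbb{R}^N:\ \sum_{i=1}^N x_i=X,\ 0\le x_i\le X_i^+ \text{ for } i=1,\dots,N\Big\}.$$ Let $g^\star(X)=\sup_{x\in B}\sum_{i=1}^N g_i(x_i)$. Let $x^\sharp\in B$ be a maximizer over $B$ of $\sum_{i=1}^N G_i(x_i)$, where $G_i(x)=\int_0^x \frac{g_i(y)}{y}\,dy$, and let $g^\sharp(X)=\sum_{i=1}^N g_i(x_i^\sharp)$. Then $$g^\sharp(X)\ \ge\ \tfrac12\, g^\star(X).$$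
   Context: A productivity function is a function $g:[0,\infty)\to[0,\infty)$ with $g(0)=0$ that is non-decreasing and concave; $g_i(x)$ is the scientific output of research unit $i$ when it receives budget $x$. It is implicit that the integrals defining $G_i$ are finite, so that $G_i$ is a well-defined (concave) function. ''Capped funding conditions'' means that the individual lower bounds on the budgets are $0$ while the upper bounds $X_i^+$ are arbitrary. *)

(* Defs.v *)
From HB Require Import structures.
From mathcomp Require Import all_boot all_order all_algebra.
From mathcomp Require Import all_classical all_reals all_analysis.

Set Implicit Arguments.
Unset Strict Implicit.
Unset Printing Implicit Defensive.

Import Order.TTheory GRing.Theory Num.Theory.
Import numFieldNormedType.Exports.

Local Open Scope classical_set_scope.
Local Open Scope ring_scope.

(* A function [0, oo) -> [0, oo) is represented by a total function R -> R of
   which only the values on [0, oo) are constrained or used. *)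
Record productivity_function (R : realType) (g : R -> R) : Prop := {
  productivity_ge0 : forall x, 0 <= x -> 0 <= g x;
  productivity_at0 : g 0 = 0;
  productivity_nondecreasing : {in `[0, +oo[ &, nondecreasing g};
  productivity_concave :
    convex_function (`[0, +oo[%classic : set R^o) (fun x : R^o => - g x)
}.

(* The integral from 0 to x is taken over ]0, x], where the division by y is
   meaningful. *)
Definition avg_productivity_integrable (R : realType) (g : R -> R) : Prop :=
  forall x : R, 0 <= x ->
    (@lebesgue_measure R).-integrable `]0, x] (EFin \o (fun y => g y / y)).

Definition cumulative_avg_productivity (R : realType) (g : R -> R) (x : R) : R :=
  \int[@lebesgue_measure R]_(y in `]0, x]) (g y / y).

(* An infinite cap +oo means that the unit has no upper bound. *)
Definition feasible_budgets (R : realType) (N : nat) (X : R)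
    (cap : 'I_N -> \bar R) : set 'rV[R]_N :=
  [set x | \sum_(i < N) x ord0 i = X /\
           forall i, 0 <= x ord0 i /\ ((x ord0 i)%:E <= cap i)%E].

Definition total_output (R : realType) (N : nat) (f : 'I_N -> R -> R)
    (x : 'rV[R]_N) : R :=
  \sum_(i < N) f i (x ord0 i).

Definition is_maximizer (R : realType) (T : Type) (B : set T) (f : T -> R)
    (x : T) : Prop :=
  B x /\ forall y, B y -> f y <= f x.

(* The library's real-valued sup is the least upper bound only for nonempty
   bounded sets.  When the positive caps sum to at least X >= 0, the set below is
   nonempty, and it is bounded above by \sum_i g i X when the g i are
   productivity functions. *)
Definition optimal_output (R : realType) (N : nat) (g : 'I_N -> R -> R) (X : R)
    (cap : 'I_N -> \bar R) : R :=
  sup [set total_output g x | x in feasible_budgets X cap].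

(* Main.v *)
Require Import Defs.
From HB Require Import structures.
From mathcomp Require Import all_boot all_order all_algebra.
From mathcomp Require Import all_classical all_reals all_analysis.
From mathcomp Require Import ring lra.

Import Order.TTheory GRing.Theory Num.Theory.
Import numFieldNormedType.Exports.

Local Open Scope classical_set_scope.
Local Open Scope ring_scope.

(** Write h_i(y) = g_i(y) / y, a non-increasing function with G_i' = h_i, and
    compare the maximizer x with an arbitrary feasible y.  For units i, j with
    x_i < y_i and y_j < x_j, moving a small budget e from j to i is feasible, so
    optimality of x gives
    h_i(y_i) <= h_i(x_i + e) <= h_j(x_j - e) <= g_j(x_j) / (x_j - e),
    and e -> 0 yields h_i(y_i) x_j <= g_j(x_j).  Since
    g_i(y_i) - g_i(x_i) <= h_i(y_i) (y_i - x_i)^+ by concavity, and the total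
    gained budget D = \sum_i (y_i - x_i)^+ equals the total lost budget
    \sum_j (x_j - y_j)^+, averaging the pairwise inequality with weights
    (y_i - x_i)^+ (x_j - y_j)^+ gives
    \sum_i g_i(y_i) - \sum_i g_i(x_i) <= \sum_j g_j(x_j). *)

Lemma integrable_cst_itvoc (R : realType) (a b c : R) :
  (@lebesgue_measure R).-integrable `]a, b] (EFin \o cst c).
Proof.
apply: (@integrableS _ _ R lebesgue_measure `[a, b]%classic) => //.
  by apply: subset_itvr; rewrite bnd_simp.
apply: continuous_compact_integrable; first exact: segment_compact.
by apply: continuous_subspaceT => x; exact: cvg_cst.
Qed.

Lemma Rintegral_cst_itvoc (R : realType) (a b c : R) : a <= b ->
  \int[@lebesgue_measure R]_(y in `]a, b]) c = c * (b - a).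
Proof.
move=> ab; rewrite Rintegral_cst//= lebesgue_measure_itv/= lte_fin.
have [_|ba] := ltP a b; first by [].
have -> : b = a by lra.
by rewrite subrr.
Qed.

Section ProductivityFunction.
Variables (R : realType) (g : R -> R).
Hypothesis hg : productivity_function g.

(** The point [a] is the convex combination of [b] and 0 with weight [a / b] on [b], and [g 0 = 0].
    This is the division-free form of the monotonicity of [g y / y], valid at 0 too. *)
Lemma productivity_star_shaped (a b : R) : 0 <= a <= b -> a * g b <= b * g a.
Proof.
case: hg => _ g0 _ cvx /andP[a0 ab].
have [b0|b0] := leP b 0.
  have -> : b = 0 by lra.
  have -> : a = 0 by lra.
  by [].
have t01 : Itv.spec (Itv.num_sem (R:=R)) (Itv.Real `[0%Z, 1%Z]) (a / b).
  rewrite /Itv.spec /Itv.num_sem /= in_itv/= num_real divr_ge0 ?(ltW b0)//=.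
  by rewrite ler_pdivrMr// mul1r.
have := cvx (Itv.mk t01) b 0.
rewrite !inE /= !in_itv /= !andbT lexx (ltW b0) => /(_ isT isT).
set c := (X in g X).
have -> : c = a by rewrite /c [LHS]convRE /= mulr0 addr0 divfK ?gt_eqF.
rewrite convRE /= g0 oppr0 mulr0 addr0.
rewrite mulrN lerN2 mulrAC ler_pdivrMr//; lra.
Qed.

Lemma avg_productivity_nonincreasing (a b : R) :
  0 < a -> a <= b -> g b / b <= g a / a.
Proof.
move=> a0 ab; have b0 := lt_le_trans a0 ab.
rewrite ler_pdivrMr// mulrAC ler_pdivlMr// mulrC [leRHS]mulrC.
by apply: productivity_star_shaped; rewrite ltW.
Qed.

(** The chord of [g] over [[a, b]] is no steeper than the chord from the origin to [b]; clearing the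
    denominator gives star-shapedness again. *)
Lemma productivity_increment_le (a b : R) :
  0 <= a -> a <= b -> g b - g a <= g b / b * (b - a).
Proof.
move=> a0 ab; have [b0|b0] := leP b 0.
  have -> : b = 0 by lra.
  have -> : a = 0 by lra.
  by rewrite !subrr mulr0.
rewrite mulrAC ler_pdivlMr//.
have /productivity_star_shaped : 0 <= a <= b by rewrite a0.
nra.
Qed.

Hypothesis hG : avg_productivity_integrable g.

Lemma cumulative_avg_productivityB (a b : R) : 0 <= a -> a <= b ->
  cumulative_avg_productivity g b - cumulative_avg_productivity g a =
  \int[@lebesgue_measure R]_(y in `]a, b]) (g y / y).
Proof.
move=> a0 ab; rewrite /cumulative_avg_productivity Rintegral_itvB//.
exact/hG/(le_trans a0).
Qed.

Lemma integrable_avg_productivity (a b : R) : 0 <= a -> a <= b ->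
  (@lebesgue_measure R).-integrable `]a, b] (EFin \o (fun y => g y / y)).
Proof.
move=> a0 ab; apply: (@integrableS _ _ R lebesgue_measure `]0, b]%classic) => //.
  by apply: subset_itvr; rewrite bnd_simp.
exact/hG/(le_trans a0).
Qed.

(** On []a, b]] the non-increasing integrand is at least its value at the right end. *)
Lemma cumulative_increment_ge (a b : R) : 0 <= a -> a <= b ->
  g b / b * (b - a) <=
  cumulative_avg_productivity g b - cumulative_avg_productivity g a.
Proof.
move=> a0 ab; rewrite cumulative_avg_productivityB// -Rintegral_cst_itvoc//.
apply: le_Rintegral => //; first exact: integrable_cst_itvoc.
  exact: integrable_avg_productivity.
move=> y /=; rewrite in_itv/= => /andP[ay yb].
by apply: avg_productivity_nonincreasing => //; exact: le_lt_trans ay.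
Qed.

(** Here the left end bounds the integrand, hence [0 < a]: at 0 the quotient is the default value
    0. *)
Lemma cumulative_increment_le (a b : R) : 0 < a -> a <= b ->
  cumulative_avg_productivity g b - cumulative_avg_productivity g a <=
  g a / a * (b - a).
Proof.
move=> a0 ab; rewrite cumulative_avg_productivityB ?(ltW a0)//.
rewrite -Rintegral_cst_itvoc//.
apply: le_Rintegral => //; last 2 first.
- exact: integrable_cst_itvoc.
- move=> y /=; rewrite in_itv/= => /andP[ay yb].
  by apply: avg_productivity_nonincreasing => //; exact: ltW.
- by apply: integrable_avg_productivity => //; exact: ltW.
Qed.

End ProductivityFunction.

Section Transfer.
Context {R : realType} {N : nat}.
Implicit Types (x y : 'rV[R]_N) (i j : 'I_N) (e : R).

(** For [i = j] the first branch wins and the total changes by [e], so the lemmas below assume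
    [i != j]. *)
Definition transfer x i j e : 'rV[R]_N :=
  \row_k (if k == i then x ord0 k + e
          else if k == j then x ord0 k - e else x ord0 k).

Lemma total_output_transfer (F : 'I_N -> R -> R) x i j e : i != j ->
  total_output F (transfer x i j e) = total_output F x
    + (F i (x ord0 i + e) - F i (x ord0 i))
    - (F j (x ord0 j) - F j (x ord0 j - e)).
Proof.
move=> ij; rewrite /total_output.
rewrite (bigD1 i)//= (bigD1 j) 1?eq_sym//=.
rewrite [X in _ = X + _ - _](bigD1 i)//=.
rewrite [X in _ = _ + X + _ - _](bigD1 j) 1?eq_sym//=.
rewrite !mxE eqxx eq_sym (negPf ij) eqxx.
rewrite (eq_bigr (fun k => F k (x ord0 k))); first ring.
by move=> k /andP[/negPf ki /negPf kj]; rewrite mxE ki kj.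
Qed.

(** The new budget of [i] lies between [x_i] and [y_i], that of [j] between [y_j] and [x_j], so each
    bound is inherited from [x] or [y]. *)
Lemma feasible_transfer (X : R) (cap : 'I_N -> \bar R) x y i j e :
  feasible_budgets X cap x -> feasible_budgets X cap y ->
  0 <= e -> e <= y ord0 i - x ord0 i -> e <= x ord0 j - y ord0 j -> i != j ->
  feasible_budgets X cap (transfer x i j e).
Proof.
move=> [sx bx] [_ by_] e0 ei ej ij; split.
  (* With identity outputs the formula expresses conservation of the total budget. *)
  have := total_output_transfer (fun _ => id) x i j e ij.
  by rewrite /total_output sx => ->; ring.
move=> k; have [xk0 xkc] := bx k; have [yk0 ykc] := by_ k.
rewrite mxE; case: eqP => [ki|_].
  subst k; split; first by rewrite addr_ge0.
  by apply: le_trans ykc; rewrite lee_fin; lra.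
case: eqP => [kj|_]; last by [].
subst k; split; first lra.
by apply: le_trans xkc; rewrite lee_fin; lra.
Qed.

End Transfer.

Section Optimality.
Context {R : realType} {N : nat} {X : R} {g : 'I_N -> R -> R}
  {cap : 'I_N -> \bar R} {x : 'rV[R]_N}.
Hypothesis hg : forall i, productivity_function (g i).
Hypothesis hG : forall i, avg_productivity_integrable (g i).
Hypothesis hx : is_maximizer (feasible_budgets X cap)
  (total_output (fun i => cumulative_avg_productivity (g i))) x.

Lemma maximizer_avg_productivity (y : 'rV[R]_N) (i j : 'I_N) :
  feasible_budgets X cap y ->
  x ord0 i < y ord0 i -> y ord0 j < x ord0 j ->
  g i (y ord0 i) / y ord0 i * x ord0 j <= g j (x ord0 j).
Proof.
move=> fy xyi yxj.
have [fx xmax] := hx.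
have [_ bx] := fx; have [xi0 _] := bx i.
have [_ by_] := fy; have [yj0 _] := by_ j.
set h := g i (y ord0 i) / y ord0 i.
have h0 : 0 <= h.
  by rewrite divr_ge0 ?(productivity_ge0 (hg i))//; lra.
have ij : i != j by apply/eqP => ij; subst j; lra.
(* A transfer below [d] overshoots [y] at neither unit and keeps [x_j - e] positive, since
   [y_j >= 0]. *)
set d := Num.min (y ord0 i - x ord0 i) (x ord0 j - y ord0 j).
have d0 : 0 < d by rewrite lt_min !subr_gt0 xyi.
have step e : 0 < e -> e < d -> h * (x ord0 j - e) <= g j (x ord0 j).
  move=> e0; rewrite lt_min => /andP[ei ej].
  have := xmax _
    (feasible_transfer _ _ _ _ _ _ _ fx fy (ltW e0) (ltW ei) (ltW ej) ij).
  rewrite total_output_transfer//.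
  have xie : x ord0 i <= x ord0 i + e by lra.
  have xje : x ord0 j - e <= x ord0 j by lra.
  have xje0 : 0 < x ord0 j - e by lra.
  have := cumulative_increment_ge _ _ (hg i) (hG i) _ _ xi0 xie.
  have := cumulative_increment_le _ _ (hg j) (hG j) _ _ xje0 xje.
  have -> : x ord0 i + e - x ord0 i = e by ring.
  have -> : x ord0 j - (x ord0 j - e) = e by ring.
  move=> lej gei opt.
  have : h <= g j (x ord0 j - e) / (x ord0 j - e).
    apply: (@le_trans _ _ (g i (x ord0 i + e) / (x ord0 i + e))).
      by apply: avg_productivity_nonincreasing => //; lra.
    rewrite -(ler_pM2r e0); lra.
  rewrite ler_pdivlMr// => /le_trans; apply.
  apply: (productivity_nondecreasing (hg j)) => //; rewrite in_itv/= andbT; lra.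
apply/ler_addgt0Pr => eps eps0.
(* The first term gives [e < d], the second [h * e <= eps]; the [+ 1] covers [h = 0]. *)
pose e := Num.min (d / 2) (eps / (h + 1)).
have e0 : 0 < e by rewrite lt_min !divr_gt0//; lra.
have ed : e < d by rewrite gt_min; apply/orP; left; lra.
have he : h * e <= eps.
  have : e <= eps / (h + 1) by rewrite ge_min lexx orbT.
  rewrite ler_pdivlMr; last lra.
  nra.
have := step _ e0 ed; lra.
Qed.

Lemma maximizer_half_optimal (y : 'rV[R]_N) :
  feasible_budgets X cap y -> total_output g y <= 2 * total_output g x.
Proof.
move=> fy; have [fx _] := hx.
have [sx bx] := fx; have [sy by_] := fy.
pose p k : R := Num.max (y ord0 k - x ord0 k) 0.
pose m k : R := Num.max (x ord0 k - y ord0 k) 0.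
pose h k := g k (y ord0 k) / y ord0 k.
have p0 k : 0 <= p k by rewrite le_max lexx orbT.
have h0 k : 0 <= h k.
  by have [yk0 _] := by_ k; rewrite divr_ge0 ?(productivity_ge0 (hg k)).
have gx0 k : 0 <= g k (x ord0 k).
  by have [xk0 _] := bx k; rewrite (productivity_ge0 (hg k)).
(* Termwise [m k - p k = x_k - y_k], and both budgets sum to [X]. *)
have pm : \sum_k m k = \sum_k p k.
  apply/eqP; rewrite -subr_eq0 -sumrB.
  rewrite (eq_bigr (fun k => x ord0 k - y ord0 k)).
    by rewrite sumrB sx sy subrr.
  move=> k _; rewrite /m /p.
  by case: (leP (x ord0 k - y ord0 k)); case: (leP (y ord0 k - x ord0 k)); lra.
have le1 : total_output g y <= total_output g x + \sum_k h k * p k.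
  rewrite /total_output -big_split/=; apply: ler_sum => k _.
  have [xk0 _] := bx k; have [yk0 _] := by_ k.
  have [xy|yx] := leP (x ord0 k) (y ord0 k).
    have := productivity_increment_le _ _ (hg k) _ _ xk0 xy.
    rewrite /p max_l ?subr_ge0// /h; lra.
  rewrite /p max_r ?subr_le0 ?(ltW yx)// mulr0 addr0.
  by apply: (productivity_nondecreasing (hg k)); rewrite ?in_itv/= ?andbT// ltW.
suff le2 : \sum_k h k * p k <= total_output g x by lra.
have D0 : 0 <= \sum_k p k by rewrite sumr_ge0.
(* If no budget is gained, every [p k] is 0; otherwise both sides can be multiplied by the positive
   total gain. *)
move: D0; rewrite le_eqVlt => /predU1P[D0|D0].
  rewrite big1 ?sumr_ge0// => k _.
  by rewrite (psumr_eq0P (fun k _ => p0 k) (esym D0) isT) mulr0.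
(* With the factor written as the sum of [m] on the left and of [p] on the right, the double sums
   compare termwise: [m_j h_i p_i <= p_i g_j(x_j)]. *)
rewrite -(ler_pM2r D0) -{1}pm mulrC [leRHS]mulrC !big_distrlr/=.
rewrite exchange_big/=; apply: ler_sum => i _; apply: ler_sum => j _.
have [yixi|xiyi] := leP (y ord0 i) (x ord0 i).
  by rewrite /p max_r ?subr_le0// !(mulr0, mul0r).
have [xjyj|yjxj] := leP (x ord0 j) (y ord0 j).
  by rewrite /m max_r ?subr_le0// mul0r mulr_ge0.
have key := maximizer_avg_productivity _ _ _ fy xiyi yjxj.
rewrite mulrA mulrC; apply: ler_wpM2l => //.
apply: le_trans key; rewrite mulrC; apply: ler_wpM2l; first exact: h0.
(* It remains that [m_j <= x_j], which holds because [y_j >= 0]. *)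
have [yj0 _] := by_ j.
rewrite /m max_l ?subr_ge0 ?(ltW yjxj)//; lra.
Qed.

End Optimality.

Theorem theorem1 (R : realType) (N : nat) (hN : (1 <= N)%N)
    (X : R) (hX : 0 < X)
    (g : 'I_N -> R -> R)
    (hg : forall i, productivity_function (g i))
    (hG : forall i, avg_productivity_integrable (g i))
    (cap : 'I_N -> \bar R)
    (hcap : forall i, (0 < cap i)%E)
    (hcapX : (X%:E <= \sum_(i < N) cap i)%E)
    (xsharp : 'rV[R]_N)
    (hxsharp : is_maximizer (feasible_budgets X cap)
       (total_output (fun i => cumulative_avg_productivity (g i))) xsharp) :
  2^-1 * optimal_output g X cap <= total_output g xsharp.
Proof.
(* Bounding [sup] by an upper bound requires a nonempty set; [xsharp] is the witness. *)
rewrite ler_pdivrMl//; apply: ge_sup.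
  by case: hxsharp => fx _; exists (total_output g xsharp), xsharp.
by move=> _ [y fy <-]; exact: (maximizer_half_optimal hg hG hxsharp).
Qed.
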